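(* Let $X$ be a Banach space and let $G\subseteq\mathcal{L}(X)$ be a compact topological group of isometries acting on $X$. If $A,B\subseteq X$ are two nonempty, convex and $G$-invariant sets, with $A$ open and $A\cap B=\emptyset$, then there exists a $G$-invariant hyperplane that separates $A$ and $B$.
   Context: $\mathcal{L}(X)$ is the space of continuous linear maps $X\to X$ with the operator norm topology; $G\subseteq \mathcal{L}(X)$ is a group (under composition) of invertible bounded linear maps with the relative topology. Functionals are real-valued. A set $K\subseteq X$ is $G$-invariant if $g(K)=K$ for every $g\in G$. An (affine) hyperplane is a set $H=\{x\in X\mid f(x)=\alpha\}$ with $f$ a nonzero linear functional and $\alpha\in\mathbb{R}$. It separates $A$ and $B$ if $f(x)\le\alpha$ for all $x\in A$ and $f(x)\ge\alpha$ for all $x\in B$. *)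

(* Defs.v *)
From HB Require Import structures.
From mathcomp Require Import all_boot all_order all_algebra.
From mathcomp Require Import all_classical all_reals all_analysis.

Set Implicit Arguments.
Unset Strict Implicit.
Unset Printing Implicit Defensive.

Import Order.TTheory GRing.Theory Num.Theory.
Import numFieldNormedType.Exports.

Local Open Scope classical_set_scope.
Local Open Scope ring_scope.

Section continuous_linear_maps.
Context {R : realType} {X : normedModType R}.

Definition clmap_pred : {pred X -> X} :=
  fun f => `[< linear f /\ continuous f >].

Record clmap := CLMap { clmap_fun :> X -> X; _ : clmap_fun \in clmap_pred }.

HB.instance Definition _ := [isSub for clmap_fun].
HB.instance Definition _ := [Choice of clmap by <:].

Lemma clmapP (f : clmap) : linear f /\ continuous f.
Proof. exact: (asboolW (valP f)). Qed.

Lemma clmap_linear (f : clmap) : linear f.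
Proof. by case: (clmapP f). Qed.

Lemma clmap_continuous (f : clmap) : continuous f.
Proof. by case: (clmapP f). Qed.

HB.instance Definition _ (f : clmap) :=
  GRing.isLinear.Build R X X _ (clmap_fun f) (clmap_linear f).

Lemma clmap_submod_closed : submod_closed clmap_pred.
Proof.
split=> [|k f g /asboolP[lf cf] /asboolP[lg cg]]; apply/asboolP; split.
- by move=> a x y; rewrite /= scaler0 addr0.
- exact: cst_continuous.
- move=> a x y; have E (z : X) : (k *: f + g) z = k *: f z + g z by [].
  by rewrite !E lf lg !scalerDr !scalerA mulrC addrACA.
- move=> x; apply: (@cvgD _ _ _ _ _ (k \*: f) g); last exact: cg.
  by apply: cvgZl_tmp; exact: cf.
Qed.

HB.instance Definition _ :=
  GRing.isSubmodClosed.Build R (X -> X) clmap_pred clmap_submod_closed.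
HB.instance Definition _ := [SubChoice_isSubLmodule of clmap by <:].

Definition opnorm (f : clmap) : R :=
  sup [set `|f x| | x in [set x : X | `|x| <= 1]].

Lemma opnorm_has_sup (f : clmap) :
  has_sup [set `|f x| | x in [set x : X | `|x| <= 1]].
Proof.
split; first by exists `|f 0|; exists 0 => //=; rewrite normr0.
have /bounded_funP/(_ 1)[M fM] :=
  continuous_linear_bounded 0 (@clmap_continuous f 0).
by exists M => _ [x x1 <-]; exact: fM.
Qed.

Lemma opnorm_ub (f : clmap) (x : X) : `|x| <= 1 -> `|f x| <= opnorm f.
Proof.
by move=> x1; apply: (ub_le_sup (opnorm_has_sup f).2); exists x.
Qed.

Lemma opnorm_le (f : clmap) (c : R) :
  (forall x, `|x| <= 1 -> `|f x| <= c) -> opnorm f <= c.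
Proof.
move=> fc; apply: ge_sup; first exact: (opnorm_has_sup f).1.
by move=> _ [x x1 <-]; exact: fc.
Qed.

Lemma opnormD (f g : clmap) : opnorm (f + g) <= opnorm f + opnorm g.
Proof.
apply: opnorm_le => x x1; apply: le_trans (ler_normD (f x) (g x)) _.
by apply: lerD; exact: opnorm_ub.
Qed.

Let opnormZ_le (k : R) (f : clmap) : opnorm (k *: f) <= `|k| * opnorm f.
Proof.
apply: opnorm_le => x x1; rewrite (_ : (k *: f) x = k *: f x)// normrZ.
by rewrite ler_wpM2l//; exact: opnorm_ub.
Qed.

Lemma opnormZ (k : R) (f : clmap) : opnorm (k *: f) = `|k| * opnorm f.
Proof.
apply/eqP; rewrite eq_le opnormZ_le /=; have [->|k0] := eqVneq k 0.
  rewrite normr0 mul0r; apply: le_trans (opnorm_ub _ (x := 0) _) => //.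
  by rewrite normr0.
have := opnormZ_le k^-1 (k *: f); rewrite scalerA mulVf// scale1r normfV.
by rewrite ler_pdivlMl ?normr_gt0.
Qed.

Lemma opnorm_eq0 (f : clmap) : opnorm f = 0 -> f = 0.
Proof.
move=> f0; apply/val_inj/funext => x /=; have [->|x0] := eqVneq x 0.
  exact: linear0.
have : `|f (`|x|^-1 *: x)| <= 0 by rewrite -f0 opnorm_ub// normfZV.
rewrite normr_le0 linearZ/= scaler_eq0 invr_eq0 normr_eq0 (negbTE x0)/=.
by move/eqP.
Qed.

(* This also equips [clmap] with the topology of the operator norm. *)
HB.instance Definition _ :=
  Lmodule_isNormed.Build R clmap opnormD opnormZ opnorm_eq0.

Lemma clmap_normE (f : clmap) : `|f| = opnorm f.
Proof. by []. Qed.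

Lemma clmap_id_subproof : (@idfun X) \in clmap_pred.
Proof. by apply/asboolP; split=> // x; exact: cvg_id. Qed.

Definition clmap_id : clmap := CLMap clmap_id_subproof.

Lemma clmap_comp_subproof (f g : clmap) : f \o g \in clmap_pred.
Proof.
apply/asboolP; split=> [k x y|x]; first by rewrite /= !linearP.
by apply: continuous_comp; exact: clmap_continuous.
Qed.

Definition clmap_comp (f g : clmap) : clmap := CLMap (clmap_comp_subproof f g).

Definition is_clmap_group (G : set clmap) : Prop :=
  [/\ G clmap_id,
      forall g h, G g -> G h -> G (clmap_comp g h) &
      forall g, G g -> exists h, [/\ G h, clmap_comp g h = clmap_id &
                                     clmap_comp h g = clmap_id]].

Definition isometric (g : clmap) : Prop :=
  forall x y : X, `|g x - g y| = `|x - y|.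

Definition invariant_under (G : set clmap) (K : set X) : Prop :=
  forall g, G g -> g @` K = K.

Definition hyperplane (f : {scalar X}) (alpha : R) : set X :=
  [set x | f x = alpha].

Definition separates (f : {scalar X}) (alpha : R) (A B : set X) : Prop :=
  (forall x, A x -> f x <= alpha) /\ (forall x, B x -> alpha <= f x).

End continuous_linear_maps.
Arguments clmap {R} X.

(* Main.v *)
(* Neither Haar measure nor a fixed point theorem is needed. Tilting the norm by
   the cone generated by B - A gives a G-invariant sublinear functional p0 such
   that every linear f <= p0 is nonnegative on B - A and nonzero. By Zorn's
   lemma there is a minimal G-invariant sublinear p <= p0, and such a p is
   linear: if p x + p (- x) > 0, then by compactness a finite net of the orbit
   G x shows that p >= - p (- x) + delta on the convex hull of the orbit for
   some delta > 0, so tilting p by the cone over G x gives a smaller invariant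
   sublinear functional. This is Kakutani's fixed point argument, carried out
   on support functions of weak* compact convex sets. *)
Require Import Defs.
From HB Require Import structures.
From mathcomp Require Import all_boot all_order all_algebra.
From mathcomp Require Import all_classical all_reals all_analysis.
From mathcomp Require Import ring lra.

Import Order.TTheory GRing.Theory Num.Theory.
Import numFieldNormedType.Exports.

Local Open Scope classical_set_scope.
Local Open Scope ring_scope.

(** * Sublinear functionals and their tilts by a convex cone *)

Definition sublinear {R : realType} {X : lmodType R} (p : X -> R) : Prop :=
  (forall x y, p (x + y) <= p x + p y) /\
  (forall (t : R) x, 0 <= t -> p (t *: x) <= t * p x).

Section sublinear.
Context {R : realType} {X : lmodType R}.
Implicit Types (p q : X -> R) (x y : X).

Lemma sublinear0 p : sublinear p -> p 0 = 0.
Proof.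
move=> [pD pZ]; have := pZ 0 0 (lexx _); have := pD 0 0.
by rewrite scale0r addr0 mul0r; lra.
Qed.

Lemma sublinearZ p (t : R) x : sublinear p -> 0 <= t -> p (t *: x) = t * p x.
Proof.
move=> sp; have [_ pZ] := sp; rewrite le_eqVlt => /predU1P[<-|t0].
  by rewrite scale0r mul0r sublinear0.
apply/eqP; rewrite eq_le; apply/andP; split; first by apply: pZ; exact: ltW.
have := pZ t^-1 (t *: x); rewrite invr_ge0 ltW// scalerA mulVf ?gt_eqF// scale1r.
by move=> /(_ isT); rewrite ler_pdivlMl.
Qed.

Lemma sublinear_geN p x : sublinear p -> - p (- x) <= p x.
Proof.
by move=> sp; have := sp.1 x (- x); rewrite subrr sublinear0//; lra.
Qed.

Lemma sublinear_sum p I (r : seq I) (F : I -> X) : sublinear p ->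
  p (\sum_(i <- r) F i) <= \sum_(i <- r) p (F i).
Proof.
move=> sp; elim/big_rec2: _ => [|i y x _ xy]; first by rewrite sublinear0.
by apply: le_trans (sp.1 _ _) _; rewrite lerD2l.
Qed.

Lemma sublinear_scalar p : sublinear p -> (forall x, p x + p (- x) <= 0) ->
  scalar p.
Proof.
move=> sp pN0.
have pN x : p (- x) = - p x.
  by have := pN0 x; have := sublinear_geN _ x sp; lra.
have pD x y : p (x + y) = p x + p y.
  have := sp.1 (x + y) (- y); have := sp.1 x y; rewrite addrK pN; lra.
move=> t x y /=; rewrite pD; congr (_ + _).
have [t0|/ltW t0] := leP 0 t; first exact: sublinearZ.
by rewrite -[t]opprK scaleNr pN sublinearZ ?oppr_ge0// !mulNr.
Qed.

(* The support function of [{f <= p | r <= f v for all (v, r) in D}]. *)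
Definition tilt p (D : set (X * R)) : X -> R :=
  fun y => inf [set p (y + d.1) - d.2 | d in D].

Definition cone_set (D : set (X * R)) : Prop :=
  [/\ D (0, 0),
      forall d e, D d -> D e -> D (d.1 + e.1, d.2 + e.2) &
      forall (t : R) d, 0 <= t -> D d -> D (t *: d.1, t * d.2)].

Section tilt.
Variables (p : X -> R) (D : set (X * R)).
Hypotheses (sp : sublinear p) (cD : cone_set D).
Hypothesis Dp : forall d, D d -> d.2 <= p d.1.

Lemma tilt_le y d : D d -> tilt p D y <= p (y + d.1) - d.2.
Proof.
move=> Dd; apply: ge_inf; last by exists d.
(* This bound keeps the infimum meaningful: [inf] of a set unbounded below is the default value
   0. *)
exists (- p (- y)) => _ [e /Dp De <-].
by have := sp.1 (y + e.1) (- y); rewrite addrC addKr; lra.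
Qed.

Lemma le_tilt y c : (forall d, D d -> c <= p (y + d.1) - d.2) -> c <= tilt p D y.
Proof.
move=> h; apply: lb_le_inf; last by move=> _ [d /h dc <-].
by have [D0 _ _] := cD; exists (p (y + 0) - 0), (0, 0).
Qed.

Lemma tilt_le_self y : tilt p D y <= p y.
Proof. by have [/(tilt_le y)] := cD; rewrite addr0 subr0. Qed.

(** Using [d] itself as competitor in the infimum forces every linear [f] below the tilt to satisfy
    [d.2 <= f d.1]. *)
Lemma tilt_opp_le d : D d -> tilt p D (- d.1) <= - d.2.
Proof. by move=> /(tilt_le (- d.1)); rewrite addNr sublinear0// add0r. Qed.

(** As [D] is a convex cone, competitors for [y] and [z] add up to one for [y + z], and competitors
    rescale with the argument. *)
Lemma tilt_sublinear : sublinear (tilt p D).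
Proof.
have [D0 DD DZ] := cD; split=> [y z|t y].
  rewrite -lerBlDl; apply: le_tilt => e De; rewrite lerBlDl -lerBlDr.
  apply: le_tilt => d Dd; rewrite lerBlDr.
  apply: le_trans (tilt_le _ _ (DD _ _ Dd De)) _ => /=.
  by have := sp.1 (y + d.1) (z + e.1); rewrite addrACA; lra.
rewrite le_eqVlt => /predU1P[<-|t0].
  by rewrite scale0r mul0r -(sublinear0 _ sp); exact: tilt_le_self.
rewrite -ler_pdivrMl//; apply: le_tilt => d Dd; rewrite ler_pdivrMl//.
apply: le_trans (tilt_le _ _ (DZ _ _ (ltW t0) Dd)) _ => /=.
by rewrite -scalerDr (sublinearZ _ _ _ sp (ltW t0)) mulrBr.
Qed.

End tilt.
End sublinear.

(** * Invariant sublinear functionals and the existence of minimal ones *)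

Section invariant_sublinear.
Context {R : realType} {X : normedModType R} (G : set (clmap X)).
Hypothesis gG : is_clmap_group G.

Definition invariant_fun (p : X -> R) : Prop :=
  forall g x, G g -> p (g x) <= p x.

Lemma invariant_funE p g x : invariant_fun p -> G g -> p (g x) = p x.
Proof.
move=> ip Gg; apply/eqP; rewrite eq_le ip//=.
have [_ _ /(_ _ Gg)[h [Gh _ hg]]] := gG.
have {1}<- : h (g x) = x := congr1 (fun k : clmap X => k x) hg.
exact: ip.
Qed.

Lemma tilt_invariant p D : sublinear p -> invariant_fun p -> cone_set D ->
  (forall d, D d -> d.2 <= p d.1) ->
  (forall g d, G g -> D d -> D (g d.1, d.2)) -> invariant_fun (tilt p D).
Proof.
move=> sp ip cD Dp GD g x Gg; apply: le_tilt => // d Dd.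
rewrite -(invariant_funE _ _ _ ip Gg) linearD.
exact: (tilt_le _ _ sp Dp (g x) (g d.1, d.2) (GD _ _ Gg Dd)).
Qed.

Lemma exists_minimal_invariant p0 : sublinear p0 -> invariant_fun p0 ->
  exists p, [/\ sublinear p, invariant_fun p, forall x, p x <= p0 x &
    forall q, sublinear q -> invariant_fun q -> (forall x, q x <= p x) -> q = p].
Proof.
move=> sp0 ip0.
pose P p := [/\ sublinear p, invariant_fun p & forall x, p x <= p0 x].
pose T := {p : X -> R | P p}.
(* The order is reversed, so a maximal element for Zorn's lemma is a minimal functional. *)
pose le (p q : T) := `[< forall x, sval q x <= sval p x >].
have [//|||A tA|p pmin] := @Zorn T le.
- by move=> p; apply/asboolP.
- move=> p q r /asboolP pq /asboolP qr; apply/asboolP => x.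
  exact: le_trans (qr x) (pq x).
- move=> [p Pp] [q Pq] /asboolP /= pq /asboolP /= qp; apply: eq_exist.
  by apply/funext => x; apply/eqP; rewrite eq_le pq qp.
- have [->|/set0P[a Aa]] := eqVneq A set0.
    have P0 : P p0 by split.
    by exists (exist _ _ P0).
  pose m x := inf [set sval p x | p in A].
  have mle p x : A p -> m x <= sval p x.
    move=> Ap; apply: ge_inf; last by exists p.
    (* All members of the chain share this lower bound at [x], since they lie below [p0] at
       [- x]. *)
    exists (- p0 (- x)) => _ [q Aq <-]; have [sq _ qp0] := svalP q.
    by have := sublinear_geN _ x sq; have := qp0 (- x); lra.
  have lem c x : (forall p, A p -> c <= sval p x) -> c <= m x.
    move=> h; apply: lb_le_inf; first by exists (sval a x), a.
    by move=> _ [p /h ? <-].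
  have Pm : P m.
    split; [split|..].
    + move=> x y; rewrite -lerBlDl; apply: (lem) => q Aq; rewrite lerBlDl -lerBlDr.
      apply: (lem) => p Ap; rewrite lerBlDr.
      (* Two members of a chain are comparable, and subadditivity of the smaller one gives the
         bound. *)
      have [/asboolP qp|/asboolP pq] := tA _ _ Ap Aq.
        have [[qD _] _ _] := svalP q.
        by have := mle _ (x + y) Aq; have := qD x y; have := qp x; lra.
      have [[pD _] _ _] := svalP p.
      by have := mle _ (x + y) Ap; have := pD x y; have := pq y; lra.
    + move=> t x; rewrite le_eqVlt => /predU1P[<-|t0].
        have [sa _ _] := svalP a.
        by rewrite scale0r mul0r -(sublinear0 _ sa); exact: mle.
      rewrite -ler_pdivrMl//; apply: (lem) => p Ap; rewrite ler_pdivrMl//.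
      have [sp _ _] := svalP p.
      by rewrite -(sublinearZ _ _ _ sp (ltW t0)); exact: mle.
    + move=> g x Gg; apply: (lem) => p Ap; apply: le_trans (mle _ _ Ap) _.
      by have [_ ip _] := svalP p; exact: ip.
    + move=> x; have [_ _ ap0] := svalP a.
      exact: le_trans (mle _ _ Aa) (ap0 x).
  by exists (exist _ _ Pm) => p Ap; apply/asboolP => x /=; exact: mle.
have [sp ip pp0] := svalP p; exists (sval p); split=> // q sq iq qp.
have Pq : P q by split=> // x; exact: le_trans (qp x) (pp0 x).
by have <- := pmin (exist _ _ Pq) (asboolT qp).
Qed.


(** * Compact orbits and linearity of minimal invariant functionals *)

Lemma clmap_norm_le (f : clmap X) x : `|f x| <= `|f| * `|x|.
Proof.
have [->|x0] := eqVneq x 0; first by rewrite linear0 !normr0 mulr0.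
have := @opnorm_ub _ _ f (`|x|^-1 *: x); rewrite normfZV// lexx => /(_ isT).
by rewrite linearZ normrZ normfV normr_id ler_pdivrMl ?normr_gt0// mulrC.
Qed.

Lemma compact_orbit_net x (e : R) : compact G -> 0 < e ->
  exists2 s : seq (clmap X), (forall h, h \in s -> G h) &
    forall g, G g -> exists2 h, h \in s & `|h x - g x| <= e.
Proof.
rewrite compact_cover => cG e0.
(* Operators within this radius differ by at most [e] at [x]; the [+ 1] covers [x = 0]. *)
have r0 : 0 < e / (`|x| + 1) by rewrite divr_gt0// ltr_wpDl.
have [h _|g Gg|s sG Gs] := cG _ G (fun h => ball h (e / (`|x| + 1))).
- exact: ball_open.
- by exists g => //; exact: ballxx.
exists (finmap.enum_fset s) => [h hs|g /Gs[h hs]].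
  by have := sG h hs; rewrite inE.
rewrite -ball_normE /= => hg; exists h => //.
have := clmap_norm_le (h - g) x; rewrite (_ : (h - g) x = h x - g x)// => le1.
apply: le_trans le1 _; move/ltW: hg; rewrite ler_pdivlMr ?ltr_wpDl// => hg.
by apply: le_trans hg; rewrite ler_wpM2l// lerDl.
Qed.

(* Points of the orbit near [h x] are compared with [h x], where [p] takes the
   value [p x]; the other ones are bounded below by [- p (- x)]. *)
Lemma orbit_combination_lower_bound p x e (h : clmap X)
    (l : seq (R * clmap X)) :
  sublinear p -> invariant_fun p -> (forall y, p y <= `|y|) -> G h ->
  (forall c, c \in l -> 0 <= c.1 /\ G c.2) ->
  (\sum_(c <- l) (if `|h x - c.2 x| <= e then c.1 else 0))
    * (p x + p (- x) - e) - (\sum_(c <- l) c.1) * p (- x)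
  <= p (\sum_(c <- l) c.1 *: c.2 x).
Proof.
move=> sp ip pnorm Gh lG.
pose w (c : R * clmap X) : R := if `|h x - c.2 x| <= e then c.1 else 0.
set W := \sum_(c <- l) (if _ then _ else _); set T := \sum_(c <- l) c.1.
set v := \sum_(c <- l) _.
have W0 : 0 <= W.
  rewrite /W big_seq; apply: sumr_ge0 => c /lG[c0 _]; by case: ifP.
have le1 : p (W *: h x - v) <= W * e + (T - W) * p (- x).
  have -> : W *: h x - v = \sum_(c <- l) (w c *: h x - c.1 *: c.2 x).
    by rewrite sumrB -scaler_suml.
  apply: le_trans (sublinear_sum _ _ _ _ sp) _.
  rewrite /W /T -sumrB !mulr_suml -big_split /= !big_seq.
  apply: ler_sum => c /lG[c0 Gc]; rewrite /w; case: ifP => [near|_].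
    rewrite -scalerBr sublinearZ// subrr mul0r addr0 ler_wpM2l//.
    exact: le_trans (pnorm _) near.
  rewrite scale0r sub0r mul0r add0r subr0 -scalerN sublinearZ// -linearN.
  by rewrite (invariant_funE _ _ _ ip Gc).
have := sp.1 v (W *: h x - v); rewrite addrC subrK sublinearZ//.
rewrite (invariant_funE _ _ _ ip Gh); lra.
Qed.

Lemma minimal_invariant_scalar p : compact G ->
  sublinear p -> invariant_fun p -> (forall y, p y <= `|y|) ->
  (forall q, sublinear q -> invariant_fun q -> (forall x, q x <= p x) -> q = p) ->
  scalar p.
Proof.
move=> cG sp ip pnorm pmin; apply: sublinear_scalar => // x.
rewrite leNgt; apply/negP => d0; set d := p x + p (- x) in d0.
have e0 : 0 < d / 2 by rewrite divr_gt0.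
have [s sG Gs] := compact_orbit_net x (d / 2) cG e0.
have [G1 GM _] := gG.
have n0 : 0 < (size s)%:R :> R.
  rewrite ltr0n lt0n; apply/eqP => /size0nil s0.
  by have [h] := Gs _ G1; rewrite s0.
(* Pigeonhole: in a convex combination of orbit points, some net point has a share of at least
   [1 / size s] of the weight within [d / 2] of it, which raises the bound [- p (- x)] by
   [d / 2 / size s]. *)
pose m := - p (- x) + d / 2 / (size s)%:R.
pose D : set (X * R) := [set z | exists l : seq (R * clmap X),
  [/\ forall c, c \in l -> 0 <= c.1 /\ G c.2,
      z.1 = \sum_(c <- l) c.1 *: c.2 x & z.2 = (\sum_(c <- l) c.1) * m]].
have cD : cone_set D.
  split.
  - by exists [::]; rewrite !big_nil mul0r.
  - move=> _ _ [k [kG /= -> ->]] [l [lG /= -> ->]]; exists (k ++ l).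
    rewrite !big_cat mulrDl; split=> // c.
    by rewrite mem_cat => /orP[/kG|/lG].
  - move=> t z t0 [l [lG -> ->]]; exists [seq (t * c.1, c.2) | c <- l].
    rewrite !big_map /= scaler_sumr mulrA mulr_sumr; split=> //.
      by move=> _ /mapP[c /lG[c0 Gc] ->]; split=> //=; exact: mulr_ge0.
    by apply: eq_bigr => c _; rewrite scalerA.
have GD g z : G g -> D z -> D (g z.1, z.2).
  move=> Gg [l [lG z1 z2]]; exists [seq (c.1, clmap_comp g c.2) | c <- l].
  rewrite !big_map /= z1 z2 linear_sum; split=> //.
    by move=> _ /mapP[c /lG[c0 Gc] ->]; split=> //=; exact: GM.
  by apply: eq_bigr => c _; rewrite linearZ.
have Dp z : D z -> z.2 <= p z.1.
  move=> [l [lG -> ->]]; rewrite -(ler_pM2l n0).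
  set T := \sum_(c <- l) c.1; set v := \sum_(c <- l) _.
  pose w (h : clmap X) := \sum_(c <- l)
    (if `|h x - c.2 x| <= d / 2 then c.1 else 0 : R).
  (* Each orbit point is close to some net point, so its weight is counted at least once. *)
  have Tw : T <= \sum_(h <- s) w h.
    rewrite /w exchange_big /= /T !big_seq; apply: ler_sum => c /lG[c0 Gc].
    have [h hs hc] := Gs _ Gc; rewrite (big_rem h)//= hc lerDl.
    by apply: sumr_ge0 => k _; case: ifP.
  have : \sum_(h <- s) (w h * (d / 2) - T * p (- x)) <= \sum_(h <- s) p v.
    rewrite !big_seq; apply: ler_sum => h hs.
    have := orbit_combination_lower_bound _ x (d / 2) _ _ sp ip pnorm (sG _ hs) lG.
    by rewrite -/d -/T -/v -/(w h) (_ : d - d / 2 = d / 2)//; lra.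
  have sum_cst (y : R) : \sum_(h <- s) y = (size s)%:R * y.
    by rewrite big_const_seq count_predT iter_addr_0 mulr_natl.
  rewrite sumrB -mulr_suml !sum_cst; apply: le_trans.
  have -> : (size s)%:R * (T * m) = T * (d / 2) - (size s)%:R * (T * p (- x)).
    rewrite /m; field; exact: lt0r_neq0.
  by rewrite lerD2r ler_pM2r.
have qp := pmin _ (tilt_sublinear _ _ sp cD Dp)
  (tilt_invariant _ _ sp ip cD Dp GD) (tilt_le_self _ _ sp cD Dp).
have Dx : D (x, m).
  exists [:: (1, clmap_id)]; rewrite !big_seq1 scale1r mul1r; split=> //.
  by move=> c; rewrite inE => /eqP ->.
(* Minimality turns the tilt back into [p], so [p (- x) <= - m], against [m > - p (- x)]. *)
have := tilt_opp_le _ _ sp Dp _ Dx; rewrite qp /= /m.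
have : 0 < d / 2 / (size s)%:R by rewrite divr_gt0.
lra.
Qed.

End invariant_sublinear.

(** * Convex sets and the cone generated by [B - A] *)

Lemma convex_set_comb (R : realType) (X : lmodType R) (A : set X) x y (s t : R) :
  @convex_set R X A -> A x -> A y -> 0 <= s -> 0 <= t ->
  exists2 z, A z & s *: x + t *: y = (s + t) *: z.
Proof.
move=> cA Ax Ay s0 t0; have := addr_ge0 s0 t0.
rewrite le_eqVlt => /predU1P[/esym st0|st0].
  (* With total weight 0 both sides vanish, and any point of [A] serves. *)
  exists x => //; rewrite st0 scale0r.
  have [-> ->] : s = 0 /\ t = 0 by split; lra.
  by rewrite !scale0r addr0.
have k0 : 0 <= s / (s + t) by rewrite divr_ge0// ltW.
have k1 : s / (s + t) <= 1 by rewrite ler_pdivrMr// mul1r lerDl.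
have /set_mem Az := cA x y (Itv01 k0 k1) (mem_set Ax) (mem_set Ay).
exists (conv (Itv01 k0 k1) (x : convex_lmodType X) y) => //.
rewrite /conv /= /unstable.onem scalerDr !scalerA mulrBr mulr1 mulrC divfK ?gt_eqF//.
by rewrite [s + t]addrC addrK.
Qed.

Section difference_cone.
Context {R : realType} {X : normedModType R} (A B : set X).
Hypotheses (cA : @convex_set R X A) (cB : @convex_set R X B).
Hypotheses (A0 : A !=set0) (B0 : B !=set0).

Definition difference_cone : set X :=
  [set z | exists t a b, [/\ 0 <= t :> R, A a, B b & z = t *: (b - a)]].

(* A linear [f] of norm 1 that is nonnegative on the cone satisfies [r <= f v]
   for these [(v, r)], as it takes values close to [- r] on the ball of radius
   [r] around 0. *)
Definition difference_cone_depth : set (X * R) :=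
  [set d | 0 <= d.2 /\ forall w, `|w| <= d.2 -> difference_cone (d.1 + w)].

Lemma difference_coneD x y :
  difference_cone x -> difference_cone y -> difference_cone (x + y).
Proof.
move=> [s [a [b [s0 Aa Bb ->]]]] [t [a' [b' [t0 Aa' Bb' ->]]]].
have [a'' Aa'' ea] := convex_set_comb _ _ _ _ _ s t cA Aa Aa' s0 t0.
have [b'' Bb'' eb] := convex_set_comb _ _ _ _ _ s t cB Bb Bb' s0 t0.
exists (s + t), a'', b''; split => //; first exact: addr_ge0.
by rewrite !scalerBr -ea -eb opprD addrACA.
Qed.

Lemma difference_coneZ (s : R) x :
  0 <= s -> difference_cone x -> difference_cone (s *: x).
Proof.
move=> s0 [t [a [b [t0 Aa Bb ->]]]]; exists (s * t), a, b.
by rewrite scalerA mulr_ge0.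
Qed.

Lemma difference_cone0 : difference_cone 0.
Proof.
have [[a Aa] [b Bb]] := (A0, B0); exists 0, a, b.
by rewrite scale0r.
Qed.

Lemma difference_cone_depth_cone : cone_set difference_cone_depth.
Proof.
split.
- split=> // w; rewrite normr_le0 => /eqP ->.
  by rewrite addr0; exact: difference_cone0.
- move=> [v r] [v' r'] [/= r0 vr] [/= r'0 vr']; split=> /=; first exact: addr_ge0.
  move=> w; have := addr_ge0 r0 r'0; rewrite le_eqVlt => /predU1P[rr|rr].
    rewrite -rr normr_le0 => /eqP ->; rewrite addr0.
    by have := difference_coneD _ _ (vr 0 _) (vr' 0 _); rewrite !addr0 normr0; exact.
  (* The perturbation [w] is shared between the two summands in proportion to [r] and [r']. *)
  move=> wr; have split_norm (s : R) : 0 <= s -> `|(s / (r + r')) *: w| <= s.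
    move=> s0; have q0 : 0 <= s / (r + r') := divr_ge0 s0 (ltW rr).
    by rewrite normrZ ger0_norm// mulrAC ler_pdivrMr//; exact: ler_wpM2l.
  have := difference_coneD _ _ (vr _ (split_norm r r0)) (vr' _ (split_norm r' r'0)).
  by rewrite addrACA -scalerDl -mulrDl divff ?gt_eqF// scale1r.
- move=> t [v r] t0 [/= r0 vr]; split=> /=; first exact: mulr_ge0.
  move=> w; move: t0; rewrite le_eqVlt => /predU1P[<-|t0].
    rewrite mul0r normr_le0 => /eqP ->; rewrite scale0r addr0.
    exact: difference_cone0.
  move=> wr; rewrite -[w](scalerKV (lt0r_neq0 t0)) -scalerDr.
  apply: difference_coneZ; first exact: ltW.
  by apply: vr; rewrite normrZ normfV gtr0_norm// ler_pdivrMl.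
Qed.

(** Otherwise the ball around [d.1] would reach past the origin and put [- e *: (b - a)] in the cone
    for some [e > 0]; by convexity [A] and [B] would then meet. *)
Lemma difference_cone_depth_le d :
  A `&` B = set0 -> difference_cone_depth d -> d.2 <= `|d.1|.
Proof.
move: d => [v r] AB [/= r0 vr]; rewrite leNgt; apply/negP => lt_vr.
have [[a Aa] [b Bb]] := (A0, B0).
(* Chosen so that [|v| + e * |b - a| <= r]. *)
pose e := (r - `|v|) / (`|b - a| + 1).
have e0 : 0 < e by rewrite divr_gt0 ?subr_gt0// ltr_wpDl.
have [|t [a' [b' [t0 Aa' Bb' E]]]] := vr (- v - e *: (b - a)).
  apply: le_trans (ler_normB _ _) _; rewrite normrN -lerBrDl normrZ gtr0_norm//.
  rewrite mulrAC ler_pdivrMr ?ltr_wpDl//; apply: ler_wpM2l; last by rewrite lerDl.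
  by rewrite subr_ge0 ltW.
have [a'' Aa'' ea] := convex_set_comb _ _ _ _ _ t e cA Aa' Aa t0 (ltW e0).
have [b'' Bb'' eb] := convex_set_comb _ _ _ _ _ t e cB Bb' Bb t0 (ltW e0).
have te0 : t + e != 0 by rewrite gt_eqF// ltr_wpDl.
suff ab : a'' = b''.
  have : (A `&` B) a'' by split=> //; rewrite ab.
  by rewrite AB.
apply: (scalerI te0); rewrite -ea -eb; apply/eqP.
rewrite eq_sym -subr_eq0 opprD addrACA -!scalerBr -E.
by rewrite addrA addrN add0r addNr.
Qed.

(** Moving [b - a] by [w] amounts to moving [a] by [- w] inside the open set [A]. The positive depth
    later makes the functional nonzero. *)
Lemma difference_cone_depth_open a b : open A -> A a -> B b ->
  exists2 r : R, 0 < r & difference_cone_depth (b - a, r).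
Proof.
move=> oA Aa Bb; have /nbhs_ballP[e /= e0 eA] := open_nbhs_nbhs (conj oA Aa).
(* Halved because depth refers to closed balls and [ball] is open. *)
exists (e / 2); first by rewrite divr_gt0.
split=> /= [|w we]; first by rewrite divr_ge0// ltW.
exists 1, (a - w), b; split => //; last by rewrite scale1r opprB addrA addrAC.
apply: eA; rewrite -ball_normE /= opprB addrC subrK.
by apply: le_lt_trans we _; rewrite ltr_pdivrMr// ltr_pMr// ltr1n.
Qed.

Lemma difference_cone_depth_invariant (G : set (clmap X)) g d :
  is_clmap_group G -> (forall h, G h -> isometric h) ->
  invariant_under G A -> invariant_under G B ->
  G g -> difference_cone_depth d -> difference_cone_depth (g d.1, d.2).
Proof.
move=> gG isoG GA GB Gg [r0 dr]; split=> //= w wr.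
(* The perturbation is pulled back by the inverse of [g], which preserves its norm. *)
have [_ _ /(_ _ Gg)[h [Gh gh _]]] := gG.
have <- : g (h w) = w := congr1 (fun k : clmap X => k w) gh.
rewrite -linearD.
have [|t [a [b [t0 Aa Bb ->]]]] := dr (h w).
  by have := isoG _ Gh w 0; rewrite linear0 !subr0 => ->.
exists t, (g a), (g b); rewrite linearZ linearB; split=> //.
  by rewrite -(GA _ Gg); exists a.
by rewrite -(GB _ Gg); exists b.
Qed.

End difference_cone.

(** * Separation by an invariant linear functional *)

Theorem theorem6 (R : realType) (X : completeNormedModType R)
    (G : set (clmap X)) (A B : set X) :
  is_clmap_group G ->
  compact G ->
  (forall g, G g -> isometric g) ->
  A !=set0 -> B !=set0 ->
  @convex_set R X A -> @convex_set R X B ->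
  invariant_under G A -> invariant_under G B ->
  open A ->
  A `&` B = set0 ->
  exists (f : {scalar X}) (alpha : R),
    [/\ exists x, f x != 0,
        invariant_under G (hyperplane f alpha) &
        separates f alpha A B].
Proof.
move=> gG cG isoG A0 B0 cA cB GA GB oA AB.
pose norm (x : X) := `|x|.
have s_norm : sublinear norm.
  split; first exact: ler_normD.
  by move=> t x t0; rewrite /norm normrZ ger0_norm.
have i_norm : invariant_fun G norm.
  by move=> g x Gg; have := isoG _ Gg x 0; rewrite linear0 !subr0 /norm => ->.
pose D := difference_cone_depth A B.
have cD : cone_set D := difference_cone_depth_cone _ _ cA cB A0 B0.
have Dn d : D d -> d.2 <= norm d.1 :=
  difference_cone_depth_le _ _ cA cB A0 B0 d AB.
have GD g d : G g -> D d -> D (g d.1, d.2) :=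
  difference_cone_depth_invariant _ _ _ g d gG isoG GA GB.
have [p [sp ip pD pmin]] := exists_minimal_invariant _ _
  (tilt_sublinear _ _ s_norm cD Dn) (tilt_invariant _ gG _ _ s_norm i_norm cD Dn GD).
have pnorm x : p x <= `|x|.
  exact: le_trans (pD x) (tilt_le_self _ _ s_norm cD Dn x).
have lp := minimal_invariant_scalar _ gG _ cG sp ip pnorm pmin.
pose f : {scalar X} := HB.pack p (GRing.isLinear.Build R X R *%R p lp).
have fD d : D d -> d.2 <= f d.1.
  (* Linearity turns the upper bound at [- d.1] into a lower bound at [d.1]. *)
  move=> Dd; have := pD (- d.1); have := tilt_opp_le _ _ s_norm Dn _ Dd.
  have -> : p (- d.1) = - f d.1 := linearN f d.1.
  lra.
have [[a0 Aa0] [b0 Bb0]] := (A0, B0).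
have fAB a b : A a -> B b -> f a <= f b.
  move=> Aa Bb; have [r r0 Dr] := difference_cone_depth_open _ _ _ _ oA Aa Bb.
  by have : r <= f (b - a) := fD _ Dr; rewrite linearB; lra.
have supA : has_sup (f @` A).
  split; first by exists (f a0), a0.
  by exists (f b0) => _ [a Aa <-]; exact: fAB.
exists f, (sup (f @` A)); split.
- exists (b0 - a0); apply: lt0r_neq0.
  have [r r0 Dr] := difference_cone_depth_open _ _ _ _ oA Aa0 Bb0.
  exact: lt_le_trans r0 (fD _ Dr).
- have fG g x : G g -> f (g x) = f x by exact: invariant_funE.
  move=> g Gg; apply/seteqP; split=> [_ [x fx <-]|x fx].
    exact: etrans (fG _ _ Gg) fx.
  (* The inverse of [g] supplies a preimage of [x] on the same level set of [f]. *)
  have [_ _ /(_ _ Gg)[h [Gh gh _]]] := gG.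
  exists (h x); last exact: (congr1 (fun k : clmap X => k x) gh).
  exact: etrans (fG _ _ Gh) fx.
- split=> [a Aa|b Bb]; first by apply: (ub_le_sup supA.2); exists a.
  by apply: ge_sup; [exact: supA.1|move=> _ [a Aa <-]; exact: fAB].
Qed.
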